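(* Let $G$ be a finite group, $H\subset G$ a subgroup, and $X=G/H$ with the left translation action of $G$. Then $(G,H)$ is a Gelfand pair if and only if $$\sum_{g,h\in G}\#X^{[g,h]}=\sum_{g,h\in G}\#X^g\cdot\#X^h\cdot\#X^{gh}.$$
   Context: For $h\in G$, $X^h=\{x\in X:hx=x\}$, and $[g,h]=ghg^{-1}h^{-1}$. A finite $G$-set $X$ is multiplicity free if $\dim\operatorname{Hom}_G(\pi,\mathbb{C}[X])\le 1$ for every irreducible complex representation $\pi$ of $G$, where $\mathbb{C}[X]$ is the representation of $G$ on complex-valued functions on $X$. The pair $(G,H)$ is a Gelfand pair if $G/H$ is a multiplicity free $G$-set. *)

(* Defs.v *)
From mathcomp Require Import all_boot all_order all_algebra all_fingroup.
From mathcomp Require Import mxrepresentation.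
From mathcomp Require Import reals complex.

Set Implicit Arguments.
Unset Strict Implicit.
Unset Printing Implicit Defensive.

Import GRing.Theory.
Local Open Scope group_scope.
Local Open Scope ring_scope.
Local Open Scope complex_scope.

(* MathComp's {action aT &-> T} are right actions, whereas left translation   *)
(* is a left action; the values of gact outside G are irrelevant.             *)
Structure finGset (gT : finGroupType) (G : {group gT}) := FinGset {
  gset_sort :> finType;
  gact : gT -> gset_sort -> gset_sort;
  gact1 : forall x, gact 1%g x = x;
  gactM : {in G &, forall g h x, gact (g * h)%g x = gact g (gact h x)}
}.

Definition gfix (gT : finGroupType) (G : {group gT}) (X : finGset G) (g : gT)
  : {set X} := [set x | gact g x == x].

Section FunctionRepresentation.

Variables (F : fieldType) (gT : finGroupType) (G : {group gT}).
Variable X : finGset G.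

(* As usual in MathComp, matrix representations act on row vectors, on the    *)
(* right; a right action f.g stands for the left action of g^-1. A function   *)
(* f on X is encoded as a row vector indexed by the enumeration of X, and     *)
(* fun_mxE says that f.g = f (g _), so that g maps f to f (g^-1 _).           *)
Definition fun_mx (g : gT) : 'M[F]_#|X| :=
  \matrix_(i, j) (enum_val i == gact g (enum_val j))%:R.

Lemma fun_mxE (f : X -> F) (g : gT) (x : X) :
  ((\row_i f (enum_val i)) *m fun_mx g) 0 (enum_rank x) = f (gact g x).
Proof.
rewrite mxE (bigD1 (enum_rank (gact g x))) //= !mxE !enum_rankK eqxx mulr1.
rewrite big1 ?addr0 // => i ne_i; rewrite !mxE enum_rankK.
by rewrite -(can_eq enum_valK) enum_rankK in ne_i; rewrite (negPf ne_i) mulr0.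
Qed.

Lemma fun_mx_repr : mx_repr G fun_mx.
Proof.
split=> [|g h Gg Gh].
  by apply/matrixP=> i j; rewrite !mxE gact1 (inj_eq enum_val_inj).
apply/matrixP=> i j; rewrite !mxE gactM //.
rewrite (bigD1 (enum_rank (gact h (enum_val j)))) //= !mxE !enum_rankK eqxx.
rewrite mulr1 big1 ?addr0 // => k ne_k; rewrite !mxE.
by rewrite -(can_eq enum_valK) enum_rankK in ne_k; rewrite (negPf ne_k) mulr0.
Qed.

Definition fun_repr : mx_representation F G #|X| :=
  MxRepresentation fun_mx_repr.

End FunctionRepresentation.

Section Intertwiners.

Variables (F : fieldType) (gT : finGroupType) (G : {group gT}) (n m : nat).
Variables (rU : mx_representation F G n) (rV : mx_representation F G m).

Definition HomG : {vspace 'M[F]_(n, m)} :=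
  (\bigcap_(g in G) lker (linfun (mulmx (rU g)) - linfun (mulmxr (rV g))))%VS.

Lemma HomGP (A : 'M[F]_(n, m)) :
  reflect {in G, forall g, rU g *m A = A *m rV g} (A \in HomG).
Proof.
rewrite memvE; apply: (iffP subv_bigcapP) => [homA g Gg | homA g Gg].
  have := homA g Gg.
  by rewrite -memvE memv_ker !lfunE /= opp_lfunE !lfunE subr_eq0 => /eqP.
by rewrite -memvE memv_ker !lfunE /= opp_lfunE !lfunE /= homA ?subrr.
Qed.

End Intertwiners.

Definition multiplicity_free (F : fieldType) (gT : finGroupType)
    (G : {group gT}) (X : finGset G) : Prop :=
  forall (n : nat) (rG : mx_representation F G n),
    mx_irreducible rG -> (\dim (HomG rG (fun_repr F X)) <= 1)%N.

Section CosetSpace.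

Variables (gT : finGroupType) (G H : {group gT}).

Definition lcoset_type := {x : {set gT} | x \in lcosets H G}.

(* insubd makes the translation total: it is the identity on x if g *: x is   *)
(* not in lcosets H G, which does not happen for g in G (lcoset_actE).        *)
Definition lcoset_act (g : gT) (x : lcoset_type) : lcoset_type :=
  insubd x (g *: val x)%g.

Lemma lcoset_actE (g : gT) (x : lcoset_type) :
  g \in G -> val (lcoset_act g x) = (g *: val x)%g.
Proof.
move=> Gg; rewrite insubdK //; have /lcosetsP[y Gy ->] := valP x.
by apply/lcosetsP; exists (g * y)%g; rewrite ?groupM // lcosetM.
Qed.

Lemma lcoset_act1 (x : lcoset_type) : lcoset_act 1%g x = x.
Proof. by apply: val_inj; rewrite lcoset_actE ?group1 // lcoset1. Qed.

Lemma lcoset_actM :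
  {in G &, forall g h x, lcoset_act (g * h)%g x = lcoset_act g (lcoset_act h x)}.
Proof.
move=> g h Gg Gh x; apply: val_inj.
by rewrite !lcoset_actE ?groupM // lcosetM.
Qed.

Definition lcoset_gset : finGset G := FinGset lcoset_act1 lcoset_actM.

Definition Gelfand_pair (F : fieldType) : Prop :=
  multiplicity_free F lcoset_gset.

End CosetSpace.

(* Main.v *)
From HB Require Import structures.
Require Import Defs.
From mathcomp Require Import all_boot all_order all_algebra all_fingroup.
From mathcomp Require Import pgroup mxrepresentation character.
From mathcomp Require Import reals complex ring.

(* Decompose C[X] into irreducibles r_k of degree d_k and put                 *)
(* m_k = dim Hom_G(r_k, C[X]) >= 1. By Schur's lemma the sum over g of        *)
(* r_k(g^-1) A r_k(g) is the scalar |G| tr A / d_k, and the sum over g of     *)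
(* #X^g r_k(g) is the scalar |G| m_k / d_k. Hence the left-hand side is the   *)
(* sum over k of |G|^2 / d_k and the right-hand side is the sum over k of     *)
(* |G|^2 m_k^2 / d_k, so they agree iff every m_k is 1.                       *)

Set Implicit Arguments.
Unset Strict Implicit.
Unset Printing Implicit Defensive.

Import Order.TTheory GRing.Theory Num.Theory.
Local Open Scope group_scope.
Local Open Scope ring_scope.

(** The number of fixed points of g is the trace of g on [fun_repr] ([mxtrace_fun_repr]), so both
    sides are sums of traces over pairs (g, h), computed one irreducible constituent at a time.
    Schur's lemma makes each average over G a scalar known from its trace: [sum_trace_commutator]
    evaluates the commutator sum on a constituent, and [sum_trace_abs_irr] an operator S such that
    the triple sum is the trace of S^2. Constituents are listed with repetition: an irreducible of
    degree d and multiplicity m contributes m |G|^2 / d on the left and m^3 |G|^2 / d on the right.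
    As m >= 1, no contribution is larger on the left, and equality forces every m to be 1. *)

(** * Averaging over G, dimensions of Hom spaces, and Schur's lemma *)

Section Averaging.

Variables (F : fieldType) (gT : finGroupType) (G : {group gT}).
Local Notation reprG := (mx_representation F G).

Lemma mxtraceJ n (rG : reprG n) (x g : gT) :
  x \in G -> g \in G -> \tr (rG (g ^ x)%g) = \tr (rG g).
Proof.
move=> Gx Gg.
by rewrite !repr_mxM ?groupM ?groupV // mxtrace_mulC repr_mxK.
Qed.

(** Summed over i and j, this says that the map A -> P A Q has trace tr P * tr Q. *)
Lemma mulmx_delta_diag m n (P : 'M[F]_m) (Q : 'M[F]_n) i j :
  (P *m delta_mx i j *m Q) i j = P i i * Q j j.
Proof.
rewrite mxE (bigD1 j) //= big1 => [|l ne_l]; rewrite mxE (bigD1 i) //= mxE eqxx.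
  by rewrite eqxx mulr1 big1 ?addr0 // => k ne_k;
    rewrite mxE (negPf ne_k) mulr0.
rewrite (negPf ne_l) mulr0 add0r big1 ?mul0r // => k ne_k.
by rewrite mxE (negPf ne_k) mulr0.
Qed.

Definition mx_average n m (rU : reprG n) (rV : reprG m) (A : 'M[F]_(n, m)) :=
  #|G|%:R^-1 *: \sum_(g in G) rU g^-1%g *m A *m rV g.

Section MxAverage.

Variables (n m : nat) (rU : reprG n) (rV : reprG m).

Lemma mx_average_is_linear : linear (mx_average rU rV).
Proof.
move=> a A B; rewrite /mx_average scalerA mulrC -scalerA -scalerDr.
congr (_ *: _); rewrite scaler_sumr -big_split; apply: eq_bigr => g _ /=.
by rewrite mulmxDr mulmxDl -scalemxAr -scalemxAl.
Qed.

HB.instance Definition _ :=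
  GRing.isSemilinear.Build F _ _ _ (mx_average rU rV)
    (GRing.semilinear_linear mx_average_is_linear).

Lemma mx_average_HomG A : mx_average rU rV A \in HomG rU rV.
Proof.
apply/HomGP => x Gx; rewrite /mx_average -scalemxAl -scalemxAr; congr (_ *: _).
rewrite mulmx_suml mulmx_sumr.
rewrite [RHS](reindex_acts 'R _ (groupVr Gx)) /=; last first.
  by apply/actsP => y Gy g; rewrite /= groupMr.
apply: eq_bigr => g Gg.
by rewrite invMg invgK !repr_mxM ?groupM ?groupV // !mulmxA repr_mxKV.
Qed.

Hypothesis nzG : #|G|%:R != 0 :> F.

Lemma mx_average_id A : A \in HomG rU rV -> mx_average rU rV A = A.
Proof.
move/HomGP=> homA; rewrite /mx_average (eq_bigr (fun=> A)) => [|g Gg].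
  by rewrite sumr_const -scaler_nat scalerA mulVf ?scale1r.
by rewrite -mulmxA -homA // mulmxA -repr_mxM ?groupV // mulVg repr_mx1 mul1mx.
Qed.

(* Both sides are the trace of the projector mx_average onto HomG: the left   *)
(* one computed on a basis of HomG, the right one on the matrix units.        *)
Lemma dim_HomG :
  (\dim (HomG rU rV))%:R * #|G|%:R
     = \sum_(g in G) \tr (rU g^-1%g) * \tr (rV g) :> F.
Proof.
pose b := vbasis (HomG rU rV); pose T := mx_average rU rV.
have TE A : T A = \sum_k coord b k (T A) *: b`_k.
  by apply/coord_vbasis/mx_average_HomG.
have TdE A : T A = \sum_i \sum_j A i j *: T (delta_mx i j).
  rewrite {1}[A]matrix_sum_delta [LHS]linear_sum; apply: eq_bigr => i _.
  by rewrite linear_sum; apply: eq_bigr => j _; apply: linearZ_LR.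
have -> : (\dim (HomG rU rV))%:R = \sum_i \sum_j (T (delta_mx i j)) i j.
  (* The projector fixes each basis vector of [HomG], which therefore contributes 1 to the trace. *)
  transitivity (\sum_k coord b k (T b`_k)).
    rewrite (eq_bigr (fun=> 1)) ?sumr_const ?card_ord // => k _.
    rewrite /T mx_average_id ?vbasis_mem ?mem_nth ?size_tuple //.
    by rewrite coord_free ?eqxx // (basis_free (vbasisP _)).
  transitivity (\sum_k \sum_i \sum_j coord b k (T (delta_mx i j)) * b`_k i j).
    apply: eq_bigr => k _; rewrite TdE linear_sum; apply: eq_bigr => i _.
    by rewrite linear_sum; apply: eq_bigr => j _; rewrite linearZ_LR mulrC.
  rewrite exchange_big; apply: eq_bigr => i _.
  rewrite exchange_big; apply: eq_bigr => j _.
  by rewrite [in RHS]TE summxE; apply: eq_bigr => k _; rewrite mxE.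
under eq_bigr => i _ do
  under eq_bigr => j _ do rewrite /T /mx_average mxE summxE.
under eq_bigr => i _ do rewrite -mulr_sumr exchange_big.
rewrite -mulr_sumr mulrC mulVKf // exchange_big; apply: eq_bigr => g _ /=.
rewrite /mxtrace mulr_suml; apply: eq_bigr => i _.
by rewrite mulr_sumr; apply: eq_bigr => j _; rewrite mulmx_delta_diag.
Qed.

End MxAverage.

Lemma mxtrace_dsum I r (P : pred I) (rG : I -> representation F G) g :
  \tr ((\big[dadd_grepr/grepr0]_(i <- r | P i) rG i) g)
    = \sum_(i <- r | P i) \tr (rG i g).
Proof.
apply: (big_morph (fun rV : representation F G => \tr (rV g))) => [rU rV|] /=.
  by rewrite mxtrace_block.
by rewrite mxtrace1.
Qed.

(** Schur's lemma: the kernel and the row space of a nonzero intertwiner are submodules, hence zero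
    and everything respectively. *)
Lemma HomG_irr_rsim n m (rU : reprG n) (rV : reprG m) :
  mx_irreducible rU -> mx_irreducible rV -> HomG rU rV != 0%VS -> mx_rsim rU rV.
Proof.
move=> /mx_irrP[_ irrU] /mx_irrP[_ irrV] nzHom.
have:= memv_pick (HomG rU rV); have:= nzHom; rewrite -vpick0.
move: (vpick _) => A nzA /HomGP homA.
have freeA : row_free A.
  rewrite -kermx_eq0; apply: contraR nzA => nzK.
  have /irrU/(_ nzK) fullK : mxmodule rU (kermx A).
    apply/mxmoduleP => g Gg; apply/sub_kermxP.
    by rewrite -mulmxA homA // mulmxA mulmx_ker mul0mx.
  by rewrite -[A]mul1mx; apply/eqP/sub_kermxP; rewrite sub1mx.
have fullA : row_full A.
  rewrite /row_full -genmxE; apply: irrV.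
    apply/mxmoduleP => g Gg; rewrite genmxE (eqmxMr _ (genmxE _)).
    by rewrite -homA // submxMl.
  by rewrite -mxrank_eq0 genmxE mxrank_eq0.
by exists A => //; rewrite -(eqP freeA) (eqP fullA).
Qed.

End Averaging.

(** * Scalars attached to an absolutely irreducible representation *)

Section Irreducible.

Variables (F : fieldType) (gT : finGroupType) (G : {group gT}).
Variables (n : nat) (rG : mx_representation F G n).
Hypothesis irrG : mx_absolutely_irreducible rG.
Hypothesis nzG : #|G|%:R != 0 :> F.

Lemma dim_HomG_abs_irr : \dim (HomG rG rG) = 1%N.
Proof.
have [n_gt0 _] := mx_abs_irrP irrG.
have -> : HomG rG rG = <[1%:M]>%VS; last first.
  by rewrite dim_vline -mxrank_eq0 mxrank1 -lt0n n_gt0.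
apply/vspaceP => A; apply/HomGP/vlineP => [homA | [a ->] g _]; last first.
  by rewrite -scalemxAl -scalemxAr mul1mx mulmx1.
have /is_scalar_mxP[a ->] : is_scalar_mx A.
  by apply: mx_abs_irr_cent_scalar irrG _ _; apply/centgmxP=> g /homA.
by exists a; rewrite scalemx1.
Qed.

Lemma mx_average_scalar (A : 'M[F]_n) : is_scalar_mx (mx_average rG rG A).
Proof.
have /HomGP homT := mx_average_HomG rG rG A.
by apply: mx_abs_irr_cent_scalar irrG _ _; apply/centgmxP=> g /homT.
Qed.

Lemma mxtrace_average (A : 'M[F]_n) : \tr (mx_average rG rG A) = \tr A.
Proof.
rewrite /mx_average linearZ linear_sum /= (eq_bigr (fun=> \tr A)) => [|g Gg].
  by rewrite sumr_const -(mulr_natl (\tr A)) mulKf.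
by rewrite mxtrace_mulC mulmxA -repr_mxM ?groupV // mulgV repr_mx1 mul1mx.
Qed.

(** Averaging a diagonal matrix unit gives a scalar matrix c of trace 1, so n c = 1 in F. *)
Lemma abs_irr_degree_neq0 : n%:R != 0 :> F.
Proof.
have [n_gt0 _] := mx_abs_irrP irrG; pose i0 := Ordinal n_gt0.
have /is_scalar_mxP[c Tc] := mx_average_scalar (delta_mx i0 i0).
have := mxtrace_average (delta_mx i0 i0).
rewrite Tc mxtrace_scalar -(mulr_natl c) /mxtrace (bigD1 i0) //= mxE !eqxx.
rewrite big1 ?addr0 => [/eqP|i ne_i]; last by rewrite mxE (negPf ne_i).
by apply: contraTneq => ->; rewrite mul0r eq_sym oner_eq0.
Qed.

Lemma scalar_mx_trace (A : 'M[F]_n) : is_scalar_mx A -> A = (\tr A / n%:R)%:M.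
Proof.
case/is_scalar_mxP=> c ->.
by rewrite mxtrace_scalar -(mulr_natr c) mulfK ?abs_irr_degree_neq0.
Qed.

(** The coefficients form a class function, so the sum commutes with [rG] and is scalar by Schur;
    its trace is given by [dim_HomG]. *)
Lemma sum_trace_abs_irr m (rV : mx_representation F G m) :
  \sum_(g in G) \tr (rV g^-1%g) *: rG g
    = (#|G|%:R * (\dim (HomG rV rG))%:R / n%:R)%:M.
Proof.
set S := LHS; have scalS : is_scalar_mx S.
  apply: mx_abs_irr_cent_scalar irrG _ _; apply/centgmxP=> x Gx.
  rewrite mulmx_suml mulmx_sumr.
  rewrite [RHS](reindex_acts 'J _ Gx) ?astabsJ ?normG //=.
  apply: eq_bigr => g Gg.
  rewrite -scalemxAl -scalemxAr -conjVg mxtraceJ ?groupV //; congr (_ *: _).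
  by rewrite -!repr_mxM ?groupJ // -conjgC.
rewrite (scalar_mx_trace scalS); congr (_ / _)%:M.
rewrite linear_sum mulrC dim_HomG //.
by apply: eq_bigr => g _; rewrite linearZ.
Qed.

(** For fixed h, the conjugates of [rG h] sum to the scalar |G| tr(h) / n. What remains is the sum
    of tr(h^-1) tr(h), which is |G| by [dim_HomG] and Schur. *)
Lemma sum_trace_commutator :
  \sum_(g in G) \sum_(h in G) \tr (rG (g * h * g^-1 * h^-1)%g)
    = #|G|%:R ^+ 2 / n%:R.
Proof.
rewrite exchange_big /=.
transitivity (\sum_(h in G) #|G|%:R / n%:R * (\tr (rG h^-1%g) * \tr (rG h))).
  (* Inverting g puts the conjugation in the order used by [mx_average]. *)
  apply: eq_bigr => h Gh; rewrite (reindex_inj invg_inj) /=.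
  rewrite (eq_bigl _ _ (groupV G)).
  transitivity (\tr (#|G|%:R *: mx_average rG rG (rG h) *m rG h^-1%g)).
    rewrite scalerA mulfV // scale1r mulmx_suml linear_sum.
    by apply: eq_bigr => g Gg; rewrite invgK !repr_mxM ?groupM ?groupV.
  rewrite (scalar_mx_trace (mx_average_scalar _)) mxtrace_average.
  rewrite -scalemxAl mul_scalar_mx scalerA mxtraceZ; ring.
by rewrite -mulr_sumr -dim_HomG // dim_HomG_abs_irr mul1r mulrAC expr2.
Qed.

End Irreducible.

(** * Decomposition into irreducibles and multiplicities *)

Section ClosedField.

Variables (F : numClosedFieldType) (gT : finGroupType) (G : {group gT}).
Local Notation reprG := (mx_representation F G).

Let nzG : #|G|%:R != 0 :> F. Proof. by rewrite pnatr_eq0 -lt0n cardG_gt0. Qed.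

Let irr_abs_irr n (rG : reprG n) :
  mx_irreducible rG -> mx_absolutely_irreducible rG.
Proof. exact: group_closure_closed_field. Qed.

(** In characteristic 0 Maschke's theorem applies, so the module is its own socle, a direct sum of
    simple submodules. *)
Lemma irr_decomposition n (rG : reprG n) :
  exists (I : finType) (rI : I -> representation F G),
    (forall i, mx_irreducible (rI i))
    /\ mx_rsim rG (\big[dadd_grepr/grepr0]_i rI i).
Proof.
have pcharG : [pchar F]^'.-group G.
  by apply: sub_pgroup (pgroup_pi G) => p _; rewrite inE /= pchar_num.
pose sG := DecSocleType rG; have S1 := Socle_semisimple sG.
rewrite (reducible_Socle1 sG (mx_Maschke_pchar rG pcharG)) in S1.
case: S1 => I U S simU defS dxS.
have modU i := mxsimple_module (simU i).
exists I, (fun i => Representation (submod_repr (modU i))); split=> [i|].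
  exact/submod_mx_irr.
apply: mx_rsim_trans (mx_rsim_sym (rsim_submod1 (mxmodule1 rG) _)) _ => //.
by apply: mx_rsim_dsum (defS) dxS _ => i; apply: mx_rsim_refl.
Qed.

Section Decomposition.

Variables (n : nat) (rG : reprG n) (I : finType) (rI : I -> representation F G).
Hypothesis irrI : forall i, mx_irreducible (rI i).
Hypothesis rGsim : mx_rsim rG (\big[dadd_grepr/grepr0]_i rI i).

Lemma mxtrace_decomposition :
  {in G, forall g, \tr (rG g) = \sum_i \tr (rI i g)}.
Proof. by move=> g Gg; rewrite (mxtrace_rsim rGsim) // mxtrace_dsum. Qed.

(** Read off the trace formula [dim_HomG], since traces add up over the constituents and F has
    characteristic 0. *)
Lemma dim_HomG_decomposition m (rU : reprG m) :
  \dim (HomG rU rG) = (\sum_i \dim (HomG rU (rI i)))%N.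
Proof.
apply/eqP; rewrite -(eqr_nat F) natr_sum; apply/eqP/(mulIf nzG).
rewrite dim_HomG // mulr_suml; under [RHS]eq_bigr do rewrite dim_HomG //.
rewrite exchange_big; apply: eq_bigr => g Gg.
by rewrite mxtrace_decomposition // mulr_sumr.
Qed.

Lemma dim_HomG_gt0 k : (0 < \dim (HomG (rI k) rG))%N.
Proof.
by rewrite dim_HomG_decomposition (bigD1 k) //= dim_HomG_abs_irr // irr_abs_irr.
Qed.

(** An irreducible with a nonzero map to some constituent is isomorphic to it and has the same
    multiplicity; any other irreducible has multiplicity 0. *)
Lemma multiplicity_le1P :
  (forall m (rU : reprG m), mx_irreducible rU -> (\dim (HomG rU rG) <= 1)%N)
  <-> (forall k, \dim (HomG (rI k) rG) = 1%N).
Proof.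
split=> [mf k | m1 m rU irrU].
  by apply/eqP; rewrite eqn_leq mf ?dim_HomG_gt0.
have [k nz_k | all0] := pickP (fun k => HomG rU (rI k) != 0%VS); last first.
  rewrite dim_HomG_decomposition big1 // => k _.
  by apply/eqP; rewrite dimv_eq0; apply: negbFE (all0 k).
have simU := HomG_irr_rsim irrU (irrI k) nz_k.
rewrite -(m1 k) -(ler_nat F) -(ler_pM2r (x := #|G|%:R)) ?ltr0n ?cardG_gt0 //.
rewrite !dim_HomG // le_eqVlt; apply/orP; left; apply/eqP/eq_bigr=> g Gg.
by rewrite (mxtrace_rsim simU) ?groupV.
Qed.

Lemma sum_trace_commutator_decomposition :
  \sum_(g in G) \sum_(h in G) \tr (rG (g * h * g^-1 * h^-1)%g)
    = \sum_k #|G|%:R ^+ 2 / (rdegree (rI k))%:R.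
Proof.
under [RHS]eq_bigr => k _ do
  rewrite -(sum_trace_commutator (irr_abs_irr (irrI k)) nzG).
rewrite [RHS]exchange_big; apply: eq_bigr => g Gg.
rewrite [RHS]exchange_big; apply: eq_bigr => h Gh.
by rewrite mxtrace_decomposition ?groupM ?groupV.
Qed.

Lemma sum_trace_triple_decomposition :
  \sum_(g in G) \sum_(h in G)
      \tr (rG g^-1%g) * \tr (rG h^-1%g) * \tr (rG (g * h)%g)
    = \sum_k #|G|%:R ^+ 2 / (rdegree (rI k))%:R
              * (\dim (HomG rG (rI k)))%:R ^+ 2.
Proof.
transitivity (\sum_k \sum_(g in G) \sum_(h in G)
   \tr (rG g^-1%g) * \tr (rG h^-1%g) * \tr (rI k (g * h)%g)).
  rewrite [RHS]exchange_big; apply: eq_bigr => g Gg.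
  rewrite [RHS]exchange_big; apply: eq_bigr => h Gh.
  by rewrite (mxtrace_decomposition (groupM Gg Gh)) mulr_sumr.
apply: eq_bigr => k _; have absk := irr_abs_irr (irrI k).
pose S := \sum_(g in G) \tr (rG g^-1%g) *: rI k g.
(* Since rI k (g h) is a product, the double sum factors; S is the scalar |G| m_k / d_k, so tr S^2 =
   d_k (|G| m_k / d_k)^2. *)
transitivity (\tr (S *m S)).
  rewrite mulmx_suml linear_sum; apply: eq_bigr => g Gg.
  rewrite mulmx_sumr linear_sum; apply: eq_bigr => h Gh.
  by rewrite -scalemxAl -scalemxAr scalerA linearZ repr_mxM.
rewrite /S sum_trace_abs_irr // -scalar_mxM mxtrace_scalar.
have nzk := abs_irr_degree_neq0 absk nzG.
by rewrite -mulr_natr; field.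
Qed.

End Decomposition.

(** * Fixed points as traces, and comparison of the two sums *)

Section FiniteGset.

Variable X : finGset G.

Lemma mxtrace_fun_repr g : \tr (fun_repr F X g) = #|gfix X g|%:R.
Proof.
rewrite /mxtrace (reindex enum_rank) /=; last first.
  exact/onW_bij/enum_rank_bij.
rewrite -[in RHS]sum1_card natr_sum [RHS]big_mkcond; apply: eq_bigr => x _.
by rewrite mxE enum_rankK inE eq_sym; case: eqP.
Qed.

Lemma gfixV g : g \in G -> gfix X g^-1%g = gfix X g.
Proof.
move=> Gg; apply/setP=> x; rewrite !inE.
apply/eqP/eqP => fix_x; rewrite -[in LHS]fix_x -Defs.gactM ?groupV //.
  by rewrite mulgV Defs.gact1.
by rewrite mulVg Defs.gact1.
Qed.

Theorem multiplicity_free_sum_commutator :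
  multiplicity_free F X <->
  (\sum_(g in G) \sum_(h in G) #|gfix X (g * h * g^-1 * h^-1)%g|
   = \sum_(g in G) \sum_(h in G)
       #|gfix X g| * #|gfix X h| * #|gfix X (g * h)%g|)%N.
Proof.
have [I [rI [irrI simI]]] := irr_decomposition (fun_repr F X).
pose m k := \dim (HomG (rI k) (fun_repr F X)).
have m_gt0 k : (0 < m k)%N by apply: dim_HomG_gt0.
(* The triple sum yields Hom out of C[X], while multiplicities are Hom into it; inverting g in
   [dim_HomG] exchanges the two. *)
have mE k : \dim (HomG (fun_repr F X) (rI k)) = m k.
  apply/eqP; rewrite -(eqr_nat F); apply/eqP/(mulIf nzG).
  rewrite !dim_HomG // (reindex_inj invg_inj) (eq_bigl _ _ (groupV G)).
  by apply: eq_bigr => g _; rewrite invgK mulrC.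
pose c k : F := #|G|%:R ^+ 2 / (rdegree (rI k))%:R.
have c_gt0 k : 0 < c k.
  have [d_gt0 _] := proj1 (mx_irrP _) (irrI k).
  by rewrite divr_gt0 ?exprn_gt0 // ltr0n ?cardG_gt0.
have lhsE : (\sum_(g in G) \sum_(h in G)
    #|gfix X (g * h * g^-1 * h^-1)%g|)%:R = \sum_k c k.
  rewrite -(sum_trace_commutator_decomposition irrI simI) natr_sum.
  apply: eq_bigr => g _; rewrite natr_sum; apply: eq_bigr => h _.
  by rewrite mxtrace_fun_repr.
have rhsE : (\sum_(g in G) \sum_(h in G)
    #|gfix X g| * #|gfix X h| * #|gfix X (g * h)%g|)%:R
    = \sum_k c k * (m k)%:R ^+ 2.
  under [RHS]eq_bigr do rewrite -mE.
  rewrite -(sum_trace_triple_decomposition irrI simI) natr_sum.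
  apply: eq_bigr => g Gg; rewrite natr_sum; apply: eq_bigr => h Gh.
  by rewrite !mxtrace_fun_repr !gfixV // !natrM.
apply: iff_trans (multiplicity_le1P irrI simI) _.
split=> [m1 | /(congr1 (GRing.natmul (1 : F)))].
  apply/eqP; rewrite -(eqr_nat F) lhsE rhsE; apply/eqP/eq_bigr => k _.
  by rewrite /m m1 expr1n mulr1.
(* Right minus left is the sum of c_k (m_k^2 - 1), whose terms are nonnegative because m_k >= 1; so
   each vanishes, and c_k > 0 gives m_k = 1. *)
rewrite lhsE rhsE => /esym/eqP; rewrite -subr_eq0 -sumrB psumr_eq0 => [|k _].
  move/allP=> eq0 k; have := eq0 k (mem_index_enum k).
  rewrite -{2}[c k]mulr1 -mulrBr mulf_eq0 gt_eqF //= subr_eq0 -natrX.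
  by rewrite (eqr_nat F _ 1) -[1%N](exp1n 2) eqn_exp2r // => /eqP.
by rewrite subr_ge0 ler_peMr ?(ltW (c_gt0 k)) // -natrX ler1n expn_gt0 m_gt0.
Qed.

End FiniteGset.

End ClosedField.

Theorem corollary4p2 (R : realType) (gT : finGroupType) (G H : {group gT})
    (sHG : H \subset G) :
  Gelfand_pair G H (complex R) <->
  (\sum_(g in G) \sum_(h in G)
      #|gfix (lcoset_gset G H) (g * h * g^-1 * h^-1)%g|
   = \sum_(g in G) \sum_(h in G)
      #|gfix (lcoset_gset G H) g| * #|gfix (lcoset_gset G H) h|
        * #|gfix (lcoset_gset G H) (g * h)%g|)%N.
Proof. exact: multiplicity_free_sum_commutator. Qed.
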